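(* Let $X$ be a path connected SLT space. Then for every $\mathbf{lpc}_0$-covering map $p:\tilde X\to X$, all fibers $p^{-1}(x)$, $x\in X$ (with the subspace topology from $\tilde X$), are homeomorphic to one another.
   Context: $\ast$ denotes concatenation of paths and $\alpha^{-1}$ the reverse path. $X$ is SLT at a point $x_0$ if for every path $\alpha$ in $X$ with $\alpha(0)=x_0$ and every neighborhood $U$ of $x_0$ there is a neighborhood $V$ of $\alpha(1)$ such that for every loop $\beta$ in $V$ based at $\alpha(1)$ there is a loop $\gamma$ in $U$ based at $x_0$ homotopic to $\alpha\ast\beta\ast\alpha^{-1}$ relative to endpoints. $X$ is an SLT space if it is SLT at every point. An $\mathbf{lpc}_0$-covering map (Brazas) is a continuous map $p:\tilde X\to X$ with $\tilde X$ path connected and locally path connected such that for every path connected, locally path connected space $Y$, every $y\in Y$, every $\tilde x\in\tilde X$, and every continuous map $f:(Y,y)\to(X,p(\tilde x))$ with $f_*\pi_1(Y,y)\subseteq p_*\pi_1(\tilde X,\tilde x)$, there is a unique continuous map $\tilde f:(Y,y)\to(\tilde X,\tilde x)$ with $p\circ\tilde f=f$. *)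

(* Defs.v *)
From HB Require Import structures.
From mathcomp Require Import all_boot all_order all_algebra.
From mathcomp Require Import all_classical reals topology normedtype.
From mathcomp Require Import continuous_path.

Set Implicit Arguments.
Unset Strict Implicit.
Unset Printing Implicit Defensive.

Import Order.TTheory GRing.Theory Num.Theory.
Import numFieldNormedType.Exports.

Local Open Scope classical_set_scope.
Local Open Scope ring_scope.

Section unit_interval.
Context (R : realType).

Definition unit_interval : Type := set_type (`[0, 1]%classic : set R).

HB.instance Definition _ :=
  Topological.copy unit_interval (set_type (`[0, 1]%classic : set R)).

Lemma clamp01_subproof (t : R) :
  Num.max 0 (Num.min 1 t) \in (`[0, 1]%classic : set R).
Proof. by rewrite inE/= in_itv/= le_max lexx/= ge_max ler01 ge_min lexx. Qed.

Definition clamp01 (t : R) : unit_interval :=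
  @exist R (fun u => u \in (`[0, 1]%classic : set R)) _ (clamp01_subproof t).

Definition itv_val (t : unit_interval) : R := set_val t.

Lemma unit_interval_neq : clamp01 0 != clamp01 1.
Proof.
apply/eqP => /(congr1 itv_val); rewrite /itv_val /clamp01 /= !set_valE /=.
rewrite (min_idPr (@ler01 R)) maxxx minxx (max_idPr (@ler01 R)) => /eqP.
by rewrite eq_sym oner_eq0.
Qed.

HB.instance Definition _ :=
  isBiPointed.Build unit_interval unit_interval_neq.

End unit_interval.

Section paths.
Context {R : realType} {X : topologicalType}.
Local Notation I := (unit_interval R).

(* The next operations are on bare functions, so that no casts are needed when
   endpoints agree only propositionally.  [path_concat a b] is meaningful when
   [a one = b zero]; [clamp01] never alters its argument in [path_concat] and
   [path_rev], it only supplies membership in [0, 1]. *)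
Definition path_concat (a b : I -> X) : I -> X := fun t =>
  if itv_val t <= 2^-1 then a (clamp01 (2 * itv_val t))
  else b (clamp01 (2 * itv_val t - 1)).

Definition path_rev (a : I -> X) : I -> X :=
  fun t => a (clamp01 (1 - itv_val t)).

(* Homotopy relative to endpoints.  The continuity of H forces a and b to be
   continuous, and they have the same endpoints. *)
Definition path_homotopic (a b : I -> X) : Prop :=
  exists H : I * I -> X,
    [/\ continuous H,
        forall t, H (t, zero) = a t,
        forall t, H (t, one) = b t,
        forall s, H (zero, s) = a zero &
        forall s, H (one, s) = a one].

Definition homotopy_class (a : I -> X) : set (I -> X) :=
  [set b | path_homotopic a b].

(* The underlying set of the fundamental group. *)
Definition pi1 (x : X) : set (set (I -> X)) :=
  range (fun g : {path I from x to x in X} => homotopy_class g).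

Definition path_connected (A : set X) : Prop :=
  forall x y, A x -> A y ->
    exists g : {path I from x to y in X}, range g `<=` A.

Definition locally_path_connected : Prop :=
  forall (x : X) (U : set X), nbhs x U ->
    exists V : set X, [/\ open V, V x, V `<=` U & path_connected V].

Definition slt_at (x0 : X) : Prop :=
  forall (x1 : X) (a : {path I from x0 to x1 in X}) (U : set X), nbhs x0 U ->
    exists2 V : set X, nbhs x1 V &
      forall b : {path I from x1 to x1 in X}, range b `<=` V ->
        exists2 g : {path I from x0 to x0 in X}, range g `<=` U &
          path_homotopic g (path_concat (path_concat a b) (path_rev a)).

Definition slt_space : Prop := forall x0 : X, slt_at x0.

End paths.

Arguments pi1 R {X} x.
Arguments path_connected R {X} A.
Arguments locally_path_connected R X : clear implicits.
Arguments slt_at R {X} x0.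
Arguments slt_space R X : clear implicits.

(* The map f_* on homotopy classes: all the f \o g for g in the class c lie in
   one class, which is the value; the union avoids choosing g. *)
Definition pi1_map {R : realType} {X Y : topologicalType} (f : X -> Y)
    (c : set (unit_interval R -> X)) : set (unit_interval R -> Y) :=
  \bigcup_(g in c) homotopy_class (f \o g).

(* pi1_map f @` pi1 R x is the subset f_*(pi1(X, x)) of pi1(Y, f x). *)
Definition lpc0_covering (R : realType) (E X : topologicalType) (p : E -> X) :
    Prop :=
  [/\ continuous p, path_connected R [set: E], locally_path_connected R E &
    forall (Y : topologicalType) (y : Y) (e : E) (f : Y -> X),
      path_connected R [set: Y] -> locally_path_connected R Y ->
      continuous f -> f y = p e ->
      pi1_map f @` pi1 R y `<=` pi1_map p @` pi1 R e ->
      exists! g : Y -> E, [/\ continuous g, g y = e & p \o g = f]].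

Definition homeomorphic (S T : topologicalType) : Prop :=
  exists (f : S -> T) (g : T -> S),
    [/\ continuous f, continuous g, cancel f g & cancel g f].

(* Sets used as types carry the initial topology of the inclusion, that is,
   the subspace topology. *)
Definition fiber (E X : topologicalType) (p : E -> X) (x : X) :
  topologicalType := set_type (p @^-1` [set x]).

(* Main.v *)
Require Import Defs.
From HB Require Import structures.
From mathcomp Require Import all_boot all_order all_algebra.
From mathcomp Require Import all_classical reals topology normedtype.
From mathcomp Require Import continuous_path.
From mathcomp Require Import ring lra.

Set Implicit Arguments.
Unset Strict Implicit.
Unset Printing Implicit Defensive.

Import Order.TTheory GRing.Theory Num.Theory.
Import numFieldNormedType.Exports.

Local Open Scope classical_set_scope.
Local Open Scope ring_scope.

(** The fibers over x and y are compared by transport: choose a path a from x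
    to y and send e over x to the end of the lift of a at e.  Existence and
    uniqueness of lifts of paths make transport along a and transport along
    the reverse path mutually inverse, so only the continuity of transport is
    at stake.

    An lpc_0-covering lifts every map from a path connected, locally path
    connected space whose loops at the base point are null-homotopic
    ([simply_lpc]), the condition on fundamental groups being then vacuous.
    Three kinds of such spaces are used.
    - The interval gives unique path lifting.
    - The square gives homotopy lifting: lifts of homotopic paths with the same
      start have the same end ([path_lift_homotopic]).
    - A cone over the set of all paths G of E issued from e, in which the legs
      of paths with small projection shrink to the apex, gives
      [small_paths_lift_small]: for every neighbourhood W of e there is a
      neighbourhood U of p e such that paths in U issued from p e lift at e to
      paths ending in W.  Indeed (G, t) |-> p (G t) is continuous on that cone,
      its lift is (G, t) |-> G t, and continuity of the lift at the apex is the
      claim.  In other words the topology of E is the one that it inherits from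
      its paths (the whisker topology).

    Continuity of transport from the fiber over y to the fiber over x along the
    reverse of a now follows from the SLT property at x
    ([lift_between_continuous]).  Let e be sent to e', let W be a neighbourhood
    of e' and let U be the neighbourhood of x = p e' given by
    [small_paths_lift_small].  Let V be the neighbourhood of y that SLT provides
    for a and U.  If e1 in the fiber is joined to e by a path d of E that stays
    over V, then p d is a loop in V, and the image of e1 is the end of the lift
    at e' of a * p d * a^-1.  That loop is homotopic to a loop in U, whose lift
    ends in W. *)

(** * The unit interval *)

Section interval.
Context {R : realType}.
Local Notation I := (unit_interval R).

Lemma itv_val01 (t : I) : 0 <= itv_val t <= 1.
Proof. by have := set_valP t; rewrite /itv_val /= in_itv. Qed.

Lemma clamp01K (r : R) : 0 <= r <= 1 -> itv_val (clamp01 r) = r.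
Proof.
move=> /andP[r0 r1]; rewrite /itv_val /clamp01 set_valE /=.
by rewrite (min_idPr r1) (max_idPr r0).
Qed.

Lemma itv_val_inj : injective (@itv_val R).
Proof. by move=> s t st; apply: val_inj; move: st; rewrite /itv_val !set_valE. Qed.

Lemma itv_val_zero : itv_val (zero : I) = 0.
Proof. by rewrite clamp01K// lexx ler01. Qed.

Lemma itv_val_one : itv_val (one : I) = 1.
Proof. by rewrite clamp01K// lexx ler01. Qed.

Lemma itv_val_continuous : continuous (@itv_val R).
Proof. exact: (@initial_continuous I R set_val). Qed.

Lemma continuous_to_interval (T : topologicalType) (f : T -> I) :
  continuous (@itv_val R \o f) -> continuous f.
Proof. by move=> cf; apply/continuous_comp_initial. Qed.

Lemma nbhs_intervalP (t : I) (U : set I) : nbhs t U <->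
  exists2 e, 0 < e & forall s, `|itv_val t - itv_val s| < e -> U s.
Proof.
split=> [[?/= [[W oW <-]] /= Wt WU]|[e e0 eU]].
  have /nbhs_ballP[e /= e0 eW] : nbhs (itv_val t) W by exact: open_nbhs_nbhs.
  by exists e => // s /eW; exact: WU.
have : nbhs t (@itv_val R @^-1` ball (itv_val t) e).
  by apply: itv_val_continuous; exact: nbhsx_ballx.
exact: filterS.
Qed.

Lemma open_neq_zero : open [set t : I | t != zero].
Proof.
have -> : [set t : I | t != zero] = @itv_val R @^-1` [set r | 0 < r].
  apply/seteqP; split=> t /=; have /andP[t0 _] := itv_val01 t.
    move=> tn0; rewrite lt_neqAle t0 andbT -itv_val_zero eq_sym.
    by apply: contra tn0 => /eqP/itv_val_inj ->.
  by move=> tp; apply/eqP => t0z; move: tp; rewrite t0z itv_val_zero ltxx.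
apply: open_comp; [by move=> ? _; exact: itv_val_continuous|exact: open_gt].
Qed.

Lemma clamp01_continuous : continuous (@clamp01 R).
Proof.
apply: continuous_to_interval => r.
have -> : @itv_val R \o @clamp01 R = fun r : R => Num.max 0 (Num.min 1 r) by [].
apply: (@continuous_max R R (cst 0) (fun r : R => Num.min 1 r)).
  exact: cvg_cst.
apply: (@continuous_min R R (cst 1) id); first exact: cvg_cst.
exact: cvg_id.
Qed.

End interval.

Section convex.
Context {R : realType}.
Local Notation I := (unit_interval R).

(** Convex combinations are the source of every explicit homotopy and of the
    contraction of the cone below. *)
Definition segment (s t u : I) : I :=
  clamp01 ((1 - itv_val u) * itv_val s + itv_val u * itv_val t).

Lemma itv_val_segment s t u :
  itv_val (segment s t u) = (1 - itv_val u) * itv_val s + itv_val u * itv_val t.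
Proof.
rewrite clamp01K//; have := itv_val01 s; have := itv_val01 t.
have := itv_val01 u; move: (itv_val u) (itv_val s) (itv_val t) => a b c.
by move=> /andP[? ?] /andP[? ?] /andP[? ?]; apply/andP; split; nra.
Qed.

Lemma segment0 s t : segment s t zero = s.
Proof. by apply: itv_val_inj; rewrite itv_val_segment itv_val_zero; ring. Qed.

Lemma segment1 s t : segment s t one = t.
Proof. by apply: itv_val_inj; rewrite itv_val_segment itv_val_one; ring. Qed.

Lemma segmentss s u : segment s s u = s.
Proof. by apply: itv_val_inj; rewrite itv_val_segment; ring. Qed.

Lemma segment_continuous (T : topologicalType) (f g h : T -> I) :
  continuous f -> continuous g -> continuous h ->
  continuous (fun x => segment (f x) (g x) (h x)).
Proof.
have cv (k : T -> I) : continuous k -> continuous (fun x => itv_val (k x)).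
  by move=> ck x; apply: continuous_comp; [exact: ck|exact: itv_val_continuous].
move=> /cv cf /cv cg /cv ch x.
apply: (@continuous_comp _ _ _ (fun x => (1 - itv_val (h x)) * itv_val (f x) +
  itv_val (h x) * itv_val (g x)) (@clamp01 R)); last exact: clamp01_continuous.
apply: cvgD; apply: cvgM; [|exact: cf|exact: ch|exact: cg].
by apply: cvgB; [exact: cvg_cst|exact: ch].
Qed.

End convex.

(** * Continuity, concatenation and homotopy of paths *)

Section pasting.
Context {R : realType} {T X : topologicalType}.

(** One form of the pasting lemma covers both the concatenation of paths and
    the vertical concatenation of homotopies. *)
Lemma continuous_paste (u : T -> R) (c : R) (f g : T -> X) :
  continuous u -> continuous f -> continuous g ->
  (forall t, u t = c -> f t = g t) ->
  continuous (fun t => if u t <= c then f t else g t).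
Proof.
move=> cu cf cg fg; set h := fun t => _.
have clA : closed [set t | u t <= c].
  by have := closed_comp (fun x _ => cu x) (@closed_le R c).
have clB : closed [set t | c <= u t].
  by have := closed_comp (fun x _ => cu x) (@closed_ge R c).
have AB : [set t | u t <= c] `|` [set t | c <= u t] = setT.
  by apply/seteqP; split=> // t _ /=; have [|/ltW] := leP (u t) c; [left|right].
have : {within [set t | u t <= c] `|` [set t | c <= u t], continuous h}.
  apply: withinU_continuous => //.
    apply: (subspace_eq_continuous (f := f)); last exact: continuous_subspaceT.
    by move=> t; rewrite inE => /= ct; rewrite /from_subspace/= /h ct.
  apply: (subspace_eq_continuous (f := g)); last exact: continuous_subspaceT.
  move=> t; rewrite inE => /= ct; rewrite /from_subspace/= /h; case: ifPn => // tc.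
  by rewrite fg//; apply/eqP; rewrite eq_le ct tc.
by rewrite AB continuous_subspace_setT.
Qed.

End pasting.

Lemma continuous_pair (T U V : topologicalType) (f : T -> U) (g : T -> V) :
  continuous f -> continuous g -> continuous (fun t => (f t, g t)).
Proof. by move=> cf cg t; apply: cvg_pair; [exact: cf|exact: cg]. Qed.

Lemma continuous_fun_comp (T U V : topologicalType) (f : T -> U) (g : U -> V) :
  continuous f -> continuous g -> continuous (g \o f).
Proof. by move=> cf cg t; apply: continuous_comp; [exact: cf|exact: cg]. Qed.

Lemma continuous_id (T : topologicalType) : continuous (fun t : T => t).
Proof. by move=> t; exact: cvg_id. Qed.

Lemma continuous_fst (T U : topologicalType) : continuous (@fst T U).
Proof. by move=> t; exact: cvg_fst. Qed.

Lemma continuous_snd (T U : topologicalType) : continuous (@snd T U).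
Proof. by move=> t; exact: cvg_snd. Qed.

Section paths.
Context {R : realType} {X : topologicalType}.
Local Notation I := (unit_interval R).

Lemma path_of_continuous (x y : X) (f : I -> X) :
  continuous f -> f zero = x -> f one = y ->
  exists g : {path I from x to y in X}, g = f :> (I -> X).
Proof. by move=> cf f0 f1; exists (mk_path cf f0 f1). Qed.

Definition flip (t : I) : I := clamp01 (1 - itv_val t).

Lemma itv_val_flip t : itv_val (flip t) = 1 - itv_val t.
Proof.
rewrite clamp01K//; have := itv_val01 t.
by move=> /andP[? ?]; apply/andP; split; lra.
Qed.

Lemma flipK : involutive flip.
Proof. by move=> t; apply: itv_val_inj; rewrite !itv_val_flip; ring. Qed.

Lemma flip0 : flip zero = one.
Proof. by apply: itv_val_inj; rewrite itv_val_flip itv_val_zero itv_val_one subr0. Qed.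

Lemma flip1 : flip one = zero.
Proof. by rewrite -flip0 flipK. Qed.

Lemma continuous_clamp01_affine (c d : R) :
  continuous (fun t : I => clamp01 (c * itv_val t + d)).
Proof.
apply: (@continuous_fun_comp _ _ _ (@itv_val R) (fun r : R => clamp01 (c * r + d))).
  exact: itv_val_continuous.
apply: (@continuous_fun_comp _ _ _ (fun r : R => c * r + d)).
  by move=> r; apply: cvgD; [apply: cvgM; [exact: cvg_cst|exact: cvg_id]|exact: cvg_cst].
exact: clamp01_continuous.
Qed.

Lemma flip_continuous : continuous flip.
Proof.
have -> : flip = fun t => clamp01 ((-1) * itv_val t + 1).
  by apply/funext => t; congr clamp01; ring.
exact: continuous_clamp01_affine.
Qed.

Lemma first_half_continuous : continuous (fun t : I => clamp01 (2 * itv_val t)).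
Proof.
under eq_fun do rewrite -[2 * _]addr0; exact: continuous_clamp01_affine.
Qed.

Lemma second_half_continuous :
  continuous (fun t : I => clamp01 (2 * itv_val t - 1)).
Proof. exact: continuous_clamp01_affine. Qed.

Lemma path_rev_continuous (a : I -> X) : continuous a -> continuous (path_rev a).
Proof.
by move=> ca; exact: continuous_fun_comp flip_continuous ca.
Qed.

Lemma path_revK : involutive (@path_rev R X).
Proof. by move=> a; apply/funext => t; rewrite /path_rev -/(flip _) flipK. Qed.

Lemma path_rev0 (a : I -> X) : path_rev a zero = a one.
Proof. by rewrite /path_rev -/(flip _) flip0. Qed.

Lemma path_rev1 (a : I -> X) : path_rev a one = a zero.
Proof. by rewrite /path_rev -/(flip _) flip1. Qed.

Lemma path_concat_continuous (a b : I -> X) :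
  continuous a -> continuous b -> a one = b zero ->
  continuous (path_concat a b).
Proof.
move=> ca cb ab; apply: continuous_paste.
- exact: itv_val_continuous.
- exact: continuous_fun_comp first_half_continuous ca.
- exact: continuous_fun_comp second_half_continuous cb.
- by move=> t /= ->; rewrite divff ?pnatr_eq0// subrr ab.
Qed.

Lemma path_concat0 (a b : I -> X) : path_concat a b zero = a zero.
Proof. by rewrite /path_concat itv_val_zero mulr0 invr_ge0 ler0n. Qed.

Lemma path_concat1 (a b : I -> X) : path_concat a b one = b one.
Proof.
rewrite /path_concat itv_val_one mulr1 ifF.
  by have -> : 2 - 1 = 1 :> R by ring.
by apply/negbTE; rewrite -ltNge invf_lt1 ?ltr1n.
Qed.

End paths.

Lemma comp_path_concat (R : realType) (X Y : topologicalType) (f : X -> Y)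
    (a b : unit_interval R -> X) :
  f \o path_concat a b = path_concat (f \o a) (f \o b).
Proof. by apply/funext => t; rewrite /path_concat /=; case: ifP. Qed.

Section homotopy.
Context {R : realType} {X : topologicalType}.
Local Notation I := (unit_interval R).

Lemma path_homotopic_ends (a b : I -> X) :
  path_homotopic a b -> a zero = b zero /\ a one = b one.
Proof. by move=> [H [_ _ H1 Hz Ho]]; rewrite -!H1 Hz Ho. Qed.

Lemma path_homotopic_refl (a : I -> X) : continuous a -> path_homotopic a a.
Proof.
move=> ca; exists (a \o fst); split=> //.
exact: continuous_fun_comp (@continuous_fst _ _) ca.
Qed.

Lemma path_homotopic_sym (a b : I -> X) :
  path_homotopic a b -> path_homotopic b a.
Proof.
move=> ab; have [a0 a1] := path_homotopic_ends ab.
move: ab => [H [cH H0 H1 Hz Ho]].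
exists (fun ts => H (ts.1, flip ts.2)); split=> //=.
- apply: (@continuous_fun_comp _ _ _ (fun ts => (ts.1, flip ts.2)) H) => //.
  apply: continuous_pair; first exact: continuous_fst.
  exact: continuous_fun_comp (@continuous_snd _ _) flip_continuous.
- by move=> t; rewrite flip0.
- by move=> t; rewrite flip1.
- by move=> s; rewrite Hz.
- by move=> s; rewrite Ho.
Qed.

Lemma path_homotopic_trans (b a c : I -> X) :
  path_homotopic a b -> path_homotopic b c -> path_homotopic a c.
Proof.
move=> ab; have [a0 a1] := path_homotopic_ends ab.
move: ab => [H [cH H0 H1 Hz Ho]] [K [cK K0 K1 Kz Ko]].
exists (fun ts => if itv_val ts.2 <= 2^-1
  then H (ts.1, clamp01 (2 * itv_val ts.2))
  else K (ts.1, clamp01 (2 * itv_val ts.2 - 1))); split=> //=.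
- apply: continuous_paste.
  + exact: continuous_fun_comp (@continuous_snd _ _) (@itv_val_continuous R).
  + apply: (@continuous_fun_comp _ _ _
      (fun ts : I * I => (ts.1, clamp01 (2 * itv_val ts.2))) H) => //.
    apply: continuous_pair; first exact: continuous_fst.
    exact: continuous_fun_comp (@continuous_snd _ _) first_half_continuous.
  + apply: (@continuous_fun_comp _ _ _
      (fun ts : I * I => (ts.1, clamp01 (2 * itv_val ts.2 - 1))) K) => //.
    apply: continuous_pair; first exact: continuous_fst.
    exact: continuous_fun_comp (@continuous_snd _ _) second_half_continuous.
  + by move=> [t s] /= ->; rewrite divff ?pnatr_eq0// subrr H1 K0.
- by move=> t; rewrite itv_val_zero mulr0 invr_ge0 ler0n H0.
- move=> t; rewrite itv_val_one mulr1 ifF.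
    by have -> : 2 - 1 = 1 :> R by ring.
  by apply/negbTE; rewrite -ltNge invf_lt1 ?ltr1n.
- by move=> s; rewrite Hz Kz -a0; case: ifP.
- by move=> s; rewrite Ho Ko -a1; case: ifP.
Qed.

Lemma path_homotopic_comp (Y : topologicalType) (f : X -> Y) (a b : I -> X) :
  continuous f -> path_homotopic a b -> path_homotopic (f \o a) (f \o b).
Proof.
move=> cf [H [cH H0 H1 Hz Ho]]; exists (f \o H); split=> /=.
- exact: continuous_fun_comp cH cf.
- by move=> t; rewrite H0.
- by move=> t; rewrite H1.
- by move=> s; rewrite Hz.
- by move=> s; rewrite Ho.
Qed.

End homotopy.

(** * Simply connected test spaces *)

Section test_spaces.
Context (R : realType).
Local Notation I := (unit_interval R).

Definition loops_null (Y : topologicalType) (y : Y) : Prop :=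
  forall g : I -> Y, continuous g -> g zero = y -> g one = y ->
    path_homotopic g (cst y).

(** The spaces on which lifting along an lpc_0-covering is unconditional.  Only
    loops at the given point are asked to be null-homotopic, which is what the
    lifting property based at that point sees. *)
Definition simply_lpc (Y : topologicalType) (y : Y) : Prop :=
  [/\ path_connected R [set: Y], locally_path_connected R Y & loops_null y].

Lemma path_connected_convex (A : set I) :
  (forall s t u, A s -> A t -> A (segment s t u)) -> path_connected R A.
Proof.
move=> convA s t As At.
have [g gE] : exists g : {path I from s to t in I}, g = segment s t :> (I -> I).
  apply: path_of_continuous; [|exact: segment0|exact: segment1].
  by apply: segment_continuous; [exact: cst_continuous|exact: cst_continuous|exact: continuous_id].
by exists g; rewrite gE => _ [u _ <-]; exact: convA.
Qed.

Lemma interval_simply_lpc (y : I) : simply_lpc y.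
Proof.
split.
- exact: path_connected_convex.
- move=> t U /nbhs_intervalP[e e0 eU].
  exists (@itv_val R @^-1` ball (itv_val t) e); split.
  + apply: open_comp; first by move=> ? _; exact: itv_val_continuous.
    exact: ball_open.
  + exact: ballxx.
  + exact: eU.
  + apply: path_connected_convex => a b u; rewrite /ball/= itv_val_segment.
    rewrite !ltr_distl => /andP[? ?] /andP[? ?].
    have /andP[? ?] := itv_val01 u.
    have pos (v w : R) : 0 < v -> 0 < w ->
        0 < (1 - itv_val u) * v + itv_val u * w.
      move=> v0 w0; have [u0|u0] := ltP 0 (itv_val u).
        by rewrite ltr_wpDl ?mulr_gt0// mulr_ge0 ?subr_ge0// ltW.
      have -> : itv_val u = 0 by apply/eqP; rewrite eq_le u0.
      by rewrite subr0 mul1r mul0r addr0.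
    have p1 : 0 < (1 - itv_val u) * (itv_val a + e - itv_val t) +
        itv_val u * (itv_val b + e - itv_val t) by apply: pos; lra.
    have p2 : 0 < (1 - itv_val u) * (itv_val t - itv_val a + e) +
        itv_val u * (itv_val t - itv_val b + e) by apply: pos; lra.
    by apply/andP; split; lra.
- move=> g cg g0 g1; exists (fun ts => segment (g ts.1) y ts.2); split=> /=.
  + apply: segment_continuous.
    * exact: continuous_fun_comp (@continuous_fst _ _) cg.
    * exact: cst_continuous.
    * exact: continuous_snd.
  + by move=> t; rewrite segment0.
  + by move=> t; rewrite segment1.
  + by move=> t; rewrite g0 segmentss.
  + by move=> t; rewrite g1 segmentss.
Qed.

Lemma path_connected_setX (Y Z : topologicalType) (A : set Y) (B : set Z) :
  path_connected R A -> path_connected R B -> path_connected R (A `*` B).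
Proof.
move=> pA pB [y z] [y' z'] [/= Ay Bz] [/= Ay' Bz'].
have [g gA] := pA _ _ Ay Ay'; have [h hB] := pB _ _ Bz Bz'.
have [k kE] : exists k : {path I from (y, z) to (y', z') in (Y * Z)%type},
    k = (fun t => (g t, h t)) :> (I -> _).
  apply: path_of_continuous; last 2 first.
  - by rewrite !path_zero.
  - by rewrite !path_one.
  - by apply: continuous_pair; exact: cts_fun.
by exists k; rewrite kE => _ [t _ <-]; split; [apply: gA|apply: hB]; exists t.
Qed.

Lemma simply_lpc_prod (Y Z : topologicalType) (y : Y) (z : Z) :
  simply_lpc y -> simply_lpc z -> simply_lpc (y, z).
Proof.
move=> [pY lY nY] [pZ lZ nZ]; split.
- by rewrite -setXTT; exact: path_connected_setX.
- move=> [a b] U [[A B] [/= /lY[A' [oA' Aa AA' pA']] /lZ[B' [oB' Bb BB' pB']]] ABU].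
  exists (A' `*` B'); split.
  + have -> : A' `*` B' = (fst @^-1` A') `&` (snd @^-1` B') by [].
    by apply: openI; apply: open_comp => // ? _; [exact: continuous_fst|exact: continuous_snd].
  + by [].
  + by apply: subset_trans ABU => -[u v] [/= /AA' ? /BB' ?].
  + exact: path_connected_setX.
- move=> g cg g0 g1.
  have [||H [cH H0 H1 Hz Ho]] := nY (fst \o g) (continuous_fun_comp cg (@continuous_fst _ _)).
  + by rewrite /= g0.
  + by rewrite /= g1.
  have [||K [cK K0 K1 Kz Ko]] := nZ (snd \o g) (continuous_fun_comp cg (@continuous_snd _ _)).
  + by rewrite /= g0.
  + by rewrite /= g1.
  exists (fun ts => (H ts, K ts)); split.
  + exact: continuous_pair.
  + by move=> t; rewrite H0 K0 /= -surjective_pairing.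
  + by move=> t; rewrite H1 K1.
  + by move=> t; rewrite Hz Kz /= -surjective_pairing.
  + by move=> t; rewrite Ho Ko /= -surjective_pairing.
Qed.

(** Two points are joined through the center of the star. *)
Lemma path_connected_star (Y : topologicalType) (y : Y) (A : set Y) :
  (forall z, A z -> exists g : {path I from z to y in Y}, range g `<=` A) ->
  path_connected R A.
Proof.
move=> star z z' /star[g gA] /star[h hA].
have [k kE] : exists k : {path I from z to z' in Y},
    k = path_concat g (path_rev h) :> (I -> _).
  apply: path_of_continuous; last 2 first.
  - by rewrite path_concat0 path_zero.
  - by rewrite path_concat1 path_rev1 path_zero.
  - apply: path_concat_continuous; first exact: cts_fun.
      by apply: path_rev_continuous; exact: cts_fun.
    by rewrite path_rev0 !path_one.
exists k; rewrite kE => _ [t _ <-]; rewrite /path_concat /path_rev.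
by case: ifP => _; [apply: gA|apply: hA]; eexists.
Qed.

End test_spaces.

(** * Cones with shrinking legs *)

Section cone.
Context {R : realType} (J : Type) (F : set_system J) (FF : Filter F).
Local Notation I := (unit_interval R).

(** The cone over J as the plain product of J and the interval.  Instead of
    being identified, the points (j, zero) will have the same neighbourhoods;
    this avoids a quotient, and separation is of no concern for lifting.  The
    proof FF is an argument so that the topology below can depend on it. *)
Definition filter_cone : Type := let _ := FF in (J * I)%type.

HB.instance Definition _ := gen_eqMixin filter_cone.
HB.instance Definition _ := gen_choiceMixin filter_cone.

(** The finest topology for which all legs are continuous, the points (j, zero)
    are indistinguishable, and the legs tend to the apex as a whole along F. *)
Definition cone_open (O : set filter_cone) : Prop :=
  (forall j, open [set t | O (j, t)]) /\
  ((exists j, O (j, zero)) ->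
    (forall j, O (j, zero)) /\ F [set j | forall t, O (j, t)]).

Let cone_openT : cone_open setT.
Proof.
split=> [j|_]; first exact: openT.
by split=> //; apply: (filterS _ filterT) => j.
Qed.

Let cone_openI : setI_closed cone_open.
Proof.
move=> A B [oA zA] [oB zB]; split=> [j|[j [Aj Bj]]].
  exact: openI (oA j) (oB j).
have [|Az FA] := zA; first by exists j.
have [|Bz FB] := zB; first by exists j.
by split=> //; apply: filterS2 FA FB => i Ai Bi t; split.
Qed.

Let cone_open_bigU (K : Type) (A : K -> set filter_cone) :
  (forall k, cone_open (A k)) -> cone_open (\bigcup_k A k).
Proof.
move=> oA; split=> [j|[j [k _ Akj]]].
  have -> : [set t | (\bigcup_k A k) (j, t)] = \bigcup_k [set t | A k (j, t)].
    by apply/seteqP; split=> t [k]; exists k.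
  by apply: bigcup_open => k _; exact: (oA k).1.
have [|Az FA] := (oA k).2; first by exists j.
split=> [i|]; first by exists k.
by apply: filterS FA => i Ai t; exists k.
Qed.

HB.instance Definition _ :=
  isOpenTopological.Build filter_cone cone_openT cone_openI cone_open_bigU.

Lemma leg_continuous (j : J) : continuous (fun t : I => (j, t) : filter_cone).
Proof. by apply/continuousP => O [+ _]; exact. Qed.

(** Away from the apex the legs are open. *)
Lemma nbhs_leg (j : J) (t : I) (A : set I) : t != zero -> nbhs t A ->
  nbhs ((j, t) : filter_cone) [set y | y.1 = j /\ A y.2].
Proof.
move=> t0; rewrite nbhsE => -[B [oB Bt] BA].
apply: (@filterS _ _ _ [set y : filter_cone | y.1 = j /\ (B y.2 /\ y.2 != zero)]).
  by move=> [i u] /= [-> [/BA]].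
apply: open_nbhs_nbhs; split=> //=; split=> [i|[i /= [_ [_]]]]; last by rewrite eqxx.
have [->|ij] := pselect (i = j).
  have -> : [set u | j = j /\ B u /\ u != zero] = B `&` [set u | u != zero].
    by apply/seteqP; split=> u /= => [[_ []]|[]].
  by apply: openI => //; exact: open_neq_zero.
have -> : [set u | i = j /\ B u /\ u != zero] = set0 by apply/seteqP; split=> u // [].
exact: open0.
Qed.

Lemma le_zero_interval (v : I) : itv_val v <= itv_val (zero : I) -> v = zero.
Proof.
rewrite itv_val_zero => v0; apply: itv_val_inj; apply/eqP.
by rewrite itv_val_zero eq_le v0 (andP (itv_val01 v)).1.
Qed.

(** The largest part of O that is star-shaped about the apex.  When O is an open
    neighbourhood of the apex so is its core; this gives both local path
    connectedness at the apex and continuity of the contraction there. *)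
Definition star_core (O : set filter_cone) : set filter_cone :=
  [set y | forall v : I, itv_val v <= itv_val y.2 -> O (y.1, v)].

Lemma star_core_open (O : set filter_cone) : open O -> open (star_core O).
Proof.
move=> [oO zO]; split=> [j|[j Oj]].
  (* If [0, t] lies in the slice of O and (t - e, t + e) does too, then so does
     [0, s] for every s within e of t. *)
  rewrite openE => t /= Ot.
  have : nbhs t [set u | O (j, u)] by apply: open_nbhs_nbhs; split; [exact: oO|exact: Ot].
  move=> /nbhs_intervalP[e e0 eO]; apply/nbhs_intervalP; exists e => // s st v vs.
  have [vt|tv] := leP (itv_val v) (itv_val t); first exact: Ot.
  apply: eO; move: st vs tv; rewrite /= !ltr_distl => /andP[? ?] ? ?.
  by apply/andP; split; lra.
have [|Oz FO] := zO; first by exists j; apply: Oj.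
split=> [i v|]; last by apply: filterS FO => i Oi t v _; exact: Oi.
by move=> /le_zero_interval ->; exact: Oz.
Qed.

Lemma star_core_sub (O : set filter_cone) : star_core O `<=` O.
Proof. by move=> [j t]; exact. Qed.

Lemma star_core_shrink (O : set filter_cone) (j : J) (t s : I) :
  star_core O (j, t) -> star_core O (j, segment t zero s).
Proof.
move=> /= Ot v vs; apply: Ot; apply: le_trans vs _ => /=.
rewrite itv_val_segment itv_val_zero mulr0 addr0.
have /andP[? ?] := itv_val01 t; have /andP[? ?] := itv_val01 s.
by rewrite ler_piMl// lerBlDr lerDl.
Qed.

Lemma continuous_cone (X : topologicalType) (x : X) (f : filter_cone -> X) :
  (forall j, continuous (fun t => f (j, t))) -> (forall j, f (j, zero) = x) ->
  (forall U, nbhs x U -> F [set j | forall t, U (f (j, t))]) ->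
  continuous f.
Proof.
move=> cf f0 fF; apply/continuousP => O oO; split=> [j|[j Oj]].
  by have /continuousP := cf j; exact.
have Ox : O x by rewrite -(f0 j).
split=> [i|]; first by rewrite /preimage/= f0.
by apply: fF; exact: open_nbhs_nbhs.
Qed.

Lemma open_cone_zero (O : set filter_cone) (i j : J) :
  open O -> O (i, zero) -> O (j, zero).
Proof. by move=> [_ zO] Oi; have [|+ _] := zO; [exists i|exact]. Qed.

(** Jumping between the points (j, zero) does not affect continuity: no open set
    separates them. *)
Lemma continuous_cone_indistinguishable (T : topologicalType)
    (f g : T -> filter_cone) :
  (forall t, g t = f t \/ ((f t).2 = zero /\ (g t).2 = zero)) ->
  continuous f -> continuous g.
Proof.
move=> fg /continuousP cf; apply/continuousP => O oO.
suff -> : g @^-1` O = f @^-1` O by exact: cf.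
apply/seteqP; split=> t /=; have [->//|[]] := fg t;
  case: (f t) => i u; case: (g t) => j v /= -> ->; exact: open_cone_zero.
Qed.

Lemma star_core_zero (O : set filter_cone) (i j : J) :
  open O -> O (i, zero) -> star_core O (j, zero).
Proof.
by move=> oO Oi v /le_zero_interval ->; exact: open_cone_zero oO Oi.
Qed.

(** Near the apex any product neighbourhood [star_core O] x [0, 1] works, whatever
    the scaling factor; elsewhere the point stays on one open leg. *)
Lemma cone_shrink_continuous :
  continuous (fun ys : filter_cone * I =>
    (ys.1.1, segment ys.1.2 zero ys.2) : filter_cone).
Proof.
move=> [[j t] s] U; rewrite nbhsE /= => -[O [oO Oj] OU].
apply: filterS OU _.
have [t0|t0] := eqVneq t zero.
  exists (star_core O, setT) => /=.
    split; last exact: filterT.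
    apply: open_nbhs_nbhs; split; first exact: star_core_open.
    by move: Oj; rewrite t0 segmentss; exact: star_core_zero.
  by move=> [[i u] r] [/= Oi _]; exact: (star_core_sub (star_core_shrink Oi)).
have : nbhs (t, s) [set ur : I * I | O (j, segment ur.1 zero ur.2)].
  apply: (@continuous_fun_comp _ _ _ (fun ur : I * I => segment ur.1 zero ur.2)
    (fun u => (j, u) : filter_cone)).
  - by apply: segment_continuous; [exact: continuous_fst|exact: cst_continuous|exact: continuous_snd].
  - exact: leg_continuous.
  - exact: open_nbhs_nbhs.
move=> [[A B] [/= At Bs] AB].
exists ([set y | y.1 = j /\ A y.2], B); first by split=> //; exact: nbhs_leg.
by move=> [[i u] r] [/= [-> Au] Br]; exact: (AB (u, r)).
Qed.

Definition apex (j : J) : filter_cone := (j, zero).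

(** The end of the contraction is set to one chosen apex, because j varies and
    homotopies must end at a single point. *)
Lemma to_apex_continuous (T : topologicalType) (f : T -> filter_cone) (h : T -> I)
    (j : J) : continuous f -> continuous h ->
  continuous (fun x => if h x == one then apex j
    else ((f x).1, segment (f x).2 zero (h x)) : filter_cone).
Proof.
move=> cf ch; apply: (@continuous_cone_indistinguishable _
  (fun x => ((f x).1, segment (f x).2 zero (h x)))).
  by move=> x; case: eqP => [->|]; [right; rewrite segment1|left].
exact: continuous_fun_comp (continuous_pair cf ch) cone_shrink_continuous.
Qed.

Lemma cone_ray (O : set filter_cone) (i j : J) (t : I) :
  star_core O (j, t) -> star_core O (apex i) ->
  exists g : {path I from (j, t) : filter_cone to apex i in filter_cone},
    range g `<=` star_core O.
Proof.
move=> Ot Oi.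
pose g (s : I) : filter_cone := if s == one then apex i else (j, segment t zero s).
have [k kE] : exists k : {path I from (j, t) : filter_cone to apex i in filter_cone},
    k = g :> (I -> filter_cone).
  apply: path_of_continuous.
  - apply: (@to_apex_continuous _ (fun _ => (j, t)) (fun s => s)).
      exact: cst_continuous.
    exact: continuous_id.
  - by rewrite /g (negbTE (unit_interval_neq R)) segment0.
  - by rewrite /g eqxx.
exists k; rewrite kE => _ [s _ <-]; rewrite /g; case: ifP => // _.
exact: star_core_shrink.
Qed.

(** The contraction fixes the chosen apex at all times, so it deforms loops at
    the apex relative to their endpoints. *)
Lemma filter_cone_simply_lpc (j : J) : simply_lpc R (apex j).
Proof.
split.
- have -> : [set: filter_cone] = star_core setT by apply/seteqP; split.
  by apply: (@path_connected_star _ _ (apex j)) => -[i t] Ot; exact: cone_ray.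
- move=> [i t] U; rewrite nbhsE => -[O [oO Oi] OU].
  have [t0|t0] := eqVneq t zero.
    have Oz k : star_core O (apex k) by apply: star_core_zero oO _; rewrite -t0; exact: Oi.
    exists (star_core O); split.
    + exact: star_core_open.
    + by rewrite t0; exact: Oz.
    + by apply: subset_trans OU; exact: star_core_sub.
    + by apply: (@path_connected_star _ _ (apex j)) => -[k u] Ok; exact: cone_ray.
  have [_ lpI _] := interval_simply_lpc (t : I).
  have [|V [oV Vt VO pV]] := lpI t ([set u | O (i, u)] `&` [set u | u != zero]).
    by apply: open_nbhs_nbhs; split=> //; apply: openI; [exact: oO.1|exact: open_neq_zero].
  exists [set y : filter_cone | y.1 = i /\ V y.2]; split.
  + rewrite openE => -[k u] /= [-> Vu].
    by apply: nbhs_leg; [exact: (VO _ Vu).2|exact: open_nbhs_nbhs].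
  + by [].
  + by move=> [k u] /= [-> /VO[Ou _]]; exact: OU.
  + move=> [k u] [l v] /= [-> Vu] [-> Vv].
    have [g gV] := pV _ _ Vu Vv.
    have [h hE] : exists h : {path I from (i, u) : filter_cone to
        ((i, v) : filter_cone) in filter_cone},
        h = (fun s => (i, g s)) :> (I -> filter_cone).
      apply: path_of_continuous; last 2 first.
      * by rewrite path_zero.
      * by rewrite path_one.
      * apply: (@continuous_fun_comp _ _ _ g (fun s => (i, s) : filter_cone)).
          exact: cts_fun.
        exact: leg_continuous.
    by exists h; rewrite hE => _ [s _ <-]; split=> //=; apply: gV; exists s.
- move=> g cg g0 g1.
  exists (fun ts => if ts.2 == one then apex j
    else ((g ts.1).1, segment (g ts.1).2 zero ts.2) : filter_cone); split=> /=.
  + apply: (@to_apex_continuous _ (g \o fst) snd); last exact: continuous_snd.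
    exact: continuous_fun_comp (@continuous_fst _ _) cg.
  + move=> t; rewrite (negbTE (unit_interval_neq R)) segment0.
    by case: (g t).
  + by move=> t; rewrite eqxx.
  + by move=> s; rewrite g0 segmentss; case: ifP.
  + by move=> s; rewrite g1 segmentss; case: ifP.
Qed.

End cone.

(** * Lifting along lpc_0-coverings *)

(** Both sides reduce to the class of constant paths. *)
Lemma pi1_map_null (R : realType) (Y E X : topologicalType) (f : Y -> X)
    (p : E -> X) (y : Y) (e : E) :
  loops_null R y -> continuous f -> continuous p -> f y = p e ->
  pi1_map f @` pi1 R y `<=` pi1_map p @` pi1 R e.
Proof.
move=> nY cf cp fy _ [_ [g _ <-] <-].
have cy : continuous (cst y : unit_interval R -> Y) by exact: cst_continuous.
have ce : continuous (cst e : unit_interval R -> E) by exact: cst_continuous.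
have fpE : f \o cst y = p \o cst e :> (unit_interval R -> X).
  by apply/funext => t /=.
have gy : path_homotopic g (cst y).
  by apply: nY; [exact: cts_fun|exact: path_zero|exact: path_one].
exists (homotopy_class (cst e)).
  have [k kE] := path_of_continuous ce (erefl : cst e zero = e) (erefl : cst e one = e).
  by exists k => //; rewrite kE.
apply/seteqP; split=> h [k].
  move=> ek pkh; exists (cst y) => //.
  apply: path_homotopic_trans pkh; rewrite /= fpE.
  exact: path_homotopic_comp.
move=> gk fkh; exists (cst e); first exact: path_homotopic_refl.
apply: path_homotopic_trans fkh; rewrite -fpE.
apply: path_homotopic_comp => //; apply: path_homotopic_trans gk.
exact: path_homotopic_sym.
Qed.

Section covering.
Context {R : realType} {E X : topologicalType} (p : E -> X).
Context (p_cov : lpc0_covering R p).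
Local Notation I := (unit_interval R).

Let cp : continuous p. Proof. by case: p_cov. Qed.

Lemma lift_exists (Y : topologicalType) (y : Y) (e : E) (f : Y -> X) :
  simply_lpc R y -> continuous f -> f y = p e ->
  exists g : Y -> E, [/\ continuous g, g y = e & p \o g = f].
Proof.
move=> [pY lY nY] cf fy; case: p_cov => _ _ _ lift.
have [g [gP _]] := lift Y y e f pY lY cf fy (pi1_map_null nY cf cp fy).
by exists g.
Qed.

Lemma lift_unique (Y : topologicalType) (y : Y) (g h : Y -> E) :
  simply_lpc R y -> continuous g -> continuous h -> g y = h y ->
  p \o g = p \o h -> g = h.
Proof.
move=> [pY lY nY] cg ch gh pgh; case: p_cov => _ _ _ lift.
have cf := continuous_fun_comp cg cp.
have [k [_ kU]] := lift Y y (g y) (p \o g) pY lY cf erefl (pi1_map_null nY cf cp erefl).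
by rewrite -(kU g)// -(kU h).
Qed.

(** The homotopy lifts to the square.  By unique lifting its horizontal sides are
    A and B, and its vertical sides, which lie over constant paths, are
    constant. *)
Lemma path_lift_homotopic (A B : I -> E) :
  continuous A -> continuous B -> A zero = B zero ->
  path_homotopic (p \o A) (p \o B) -> A one = B one.
Proof.
move=> cA cB AB [H [cH H0 H1 Hz Ho]].
have sI t := @interval_simply_lpc R t.
have [|L [cL L0 pL]] := lift_exists (e := A zero)
  (simply_lpc_prod (sI zero) (sI zero)) cH; first by rewrite H0.
have pLE ts : p (L ts) = H ts by rewrite -pL.
have cpair (f g : I -> I) : continuous f -> continuous g ->
    continuous (fun t => L (f t, g t)).
  by move=> cf cg; exact: continuous_fun_comp (continuous_pair cf cg) cL.
have idc := @continuous_id I.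
have cc (c : I) : continuous (fun _ : I => c) by exact: cst_continuous.
have bottom : (fun t => L (t, zero)) = A.
  apply: (lift_unique (sI zero)) => //; first exact: cpair.
  by apply/funext => t /=; rewrite pLE H0.
have left_side : (fun s => L (zero, s)) = fun=> A zero.
  apply: (lift_unique (sI zero)) => //; first exact: cpair.
    exact: cst_continuous.
  by apply/funext => s /=; rewrite pLE Hz.
have top : (fun t => L (t, one)) = B.
  apply: (lift_unique (sI zero)) => //; first exact: cpair.
    by rewrite -AB -(congr1 (fun f => f one) left_side).
  by apply/funext => t /=; rewrite pLE H1.
have right_side : (fun s => L (one, s)) = fun=> A one.
  apply: (lift_unique (sI zero)) => //; first exact: cpair.
  - exact: cst_continuous.
  - by rewrite -(congr1 (fun f => f one) bottom).
  - by apply/funext => s /=; rewrite pLE Ho.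
by rewrite -top -(congr1 (fun f => f one) right_side).
Qed.

(** The topology of E near e is controlled by paths in X.  All paths of E issued
    from e are lifted at once, by a single map defined on a cone with one leg
    for each of them. *)
Lemma small_paths_lift_small (e : E) (W : set E) : nbhs e W ->
  exists2 U, nbhs (p e) U & forall G : I -> E, continuous G -> G zero = e ->
    range (p \o G) `<=` U -> W (G one).
Proof.
move=> eW.
pose J := {G : I -> E | continuous G /\ G zero = e}.
pose small (U : set X) : set J := [set G : J | range (p \o sval G) `<=` U].
pose F : set_system J := [set A | exists2 U, nbhs (p e) U & small U `<=` A].
have FF : Filter F.
  split.
  - by exists setT => //; exact: filterT.
  - move=> A B [U eU UA] [V eV VB]; exists (U `&` V); first exact: filterI.
    by move=> G GUV; split; [apply: UA|apply: VB] => x /GUV [].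
  - by move=> A B AB [U eU UA]; exists U => // G /UA /AB.
have cste : continuous (cst e : I -> E) /\ cst e (zero : I) = e.
  by split=> //; exact: cst_continuous.
pose j0 : J := exist _ (cst e) cste.
pose f (y : filter_cone (R := R) FF) : X := p (sval y.1 y.2).
have f0 j : f (j, zero) = p e by rewrite /f /= (proj2_sig j).2.
have cf : continuous f.
  apply: (continuous_cone _ f0) => [j|U eU].
    exact: continuous_fun_comp (proj2_sig j).1 cp.
  by exists U => // G GU t; apply: GU; exists t.
have [|L [cL L0 pL]] := lift_exists (e := e) (filter_cone_simply_lpc FF j0) cf.
  exact: f0.
have pLE y : p (L y) = f y by rewrite -pL.
(* All the points (j, zero) have the same neighbourhoods, so that jumping from
   one to another is a path; it lies over p e, hence its lift is constant. *)
have Lz j : L (j, zero) = e.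
  pose jump (t : I) : filter_cone (R := R) FF := if t == zero then (j0, zero) else (j, zero).
  have cjump : continuous jump.
    apply: (@continuous_cone_indistinguishable _ _ _ _ _ (fun _ => (j, zero))).
      by move=> t; rewrite /jump; case: ifP; [right|left].
    exact: cst_continuous.
  have /(congr1 (fun g => g one)) : L \o jump = cst e.
    apply: (lift_unique (@interval_simply_lpc R zero)).
    - exact: continuous_fun_comp cjump cL.
    - exact: cst_continuous.
    - by rewrite /= /jump eqxx.
    - by apply/funext => t /=; rewrite pLE /jump; case: ifP; rewrite f0.
  by rewrite /= /jump eq_sym (negbTE (unit_interval_neq R)).
have Lleg (j : J) t : L (j, t) = sval j t.
  have [cj jz] := proj2_sig j.
  have /(congr1 (fun g => g t)) : (fun t => L (j, t)) = sval j.
    apply: (lift_unique (@interval_simply_lpc R zero)) => //.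
    - apply: (@continuous_fun_comp _ _ _
        (fun t => (j, t) : filter_cone (R := R) FF) L) => //; exact: leg_continuous.
    - by rewrite Lz jz.
    - by apply/funext => s /=; rewrite pLE.
  by [].
have nW : nbhs (apex FF j0 : filter_cone (R := R) FF) (L @^-1` W) by apply: cL; rewrite L0.
rewrite nbhsE in nW; have [O [oO Oj] OW] := nW.
have [|_ [U eU UO]] := oO.2; first by exists j0.
exists U => // G cG G0 GU.
have := OW _ (UO (exist _ G (conj cG G0)) GU one).
by rewrite /= Lleg.
Qed.

(** * Transport between fibers *)

(** Transport along a, as a relation between the ends of a lift of a. *)
Definition lift_between (a : I -> X) (e e' : E) : Prop :=
  exists A : I -> E, [/\ continuous A, A zero = e, A one = e' & p \o A = a].

Lemma lift_between_exists (a : I -> X) (e : E) :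
  continuous a -> a zero = p e -> exists e', lift_between a e e'.
Proof.
move=> ca ae; have [A [cA A0 pA]] := lift_exists (@interval_simply_lpc R zero) ca ae.
by exists (A one), A.
Qed.

Lemma lift_between_fun (a : I -> X) (e e1 e2 : E) :
  lift_between a e e1 -> lift_between a e e2 -> e1 = e2.
Proof.
move=> [A [cA A0 <- pA]] [B [cB B0 <- pB]].
suff -> : A = B by [].
by apply: (lift_unique (@interval_simply_lpc R zero)); rewrite ?A0 ?pA.
Qed.

Lemma lift_between_rev (a : I -> X) (e e' : E) :
  lift_between a e e' -> lift_between (path_rev a) e' e.
Proof.
move=> [A [cA A0 A1 <-]]; exists (path_rev A); split=> //.
- exact: path_rev_continuous.
- by rewrite path_rev0.
- by rewrite path_rev1.
Qed.

(** The only place where the SLT property enters: it trades the loop obtained by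
    following a, a small loop at y and the reverse of a for a small loop at x,
    which [small_paths_lift_small] controls. *)
Lemma lift_between_continuous (x y : X) (a : {path I from x to y in X})
    (e e' : E) (W : set E) :
  slt_at R x -> p e = y -> lift_between (path_rev a) e e' -> nbhs e' W ->
  exists2 N, nbhs e N & forall e1 e1', N e1 -> p e1 = y ->
    lift_between (path_rev a) e1 e1' -> W e1'.
Proof.
move=> sltx pe ee' /small_paths_lift_small [U].
have -> : p e' = x.
  by move: ee' => [A [_ _ <- pA]]; rewrite -[p _]/((p \o A) one) pA path_rev1 path_zero.
move=> /(sltx _ a)[V yV sltV] Wsmall.
have [_ _ lE _] := p_cov.
have [|N [oN Ne NV pN]] := lE e (p @^-1` V); first by apply: cp; rewrite pe.
exists N; first exact: open_nbhs_nbhs.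
move=> e1 e1' Ne1 pe1 [B [cB B0 B1 pB]].
have [d dN] := pN _ _ Ne Ne1.
have [|||b bE] := @path_of_continuous R X y y (p \o d).
- exact: continuous_fun_comp (@cts_fun _ _ d) cp.
- by rewrite /= path_zero.
- by rewrite /= path_one.
have [|g gU gh] := sltV b.
  by rewrite bE => _ [t _ <-]; apply: NV; apply: dN; exists t.
have [A [cA A0 A1 pA]] := lift_between_rev ee'.
rewrite path_revK in pA.
have cAd : continuous (path_concat A d).
  by apply: path_concat_continuous => //; [exact: cts_fun|rewrite A1 path_zero].
have cL : continuous (path_concat (path_concat A d) B).
  by apply: path_concat_continuous => //; rewrite path_concat1 path_one B0.
have [|G [cG G0 pG]] := lift_exists (e := e') (@interval_simply_lpc R zero) (@cts_fun _ _ g).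
  by rewrite -A0 -[p _]/((p \o A) zero) pA path_zero; exact: path_zero.
(* Lifted at e', the loop a * p d * a^-1 runs back to e, along d to e1, and
   ends at e1'; the small loop g is homotopic to it. *)
have <- : G one = e1'.
  rewrite -B1 -(path_concat1 (path_concat A d) B).
  apply: path_lift_homotopic => //; first by rewrite !path_concat0 G0 A0.
  by rewrite !comp_path_concat pA pB -bE pG.
by apply: Wsmall => //; rewrite pG.
Qed.

Lemma fiber_transport (x y : X) (a : {path I from x to y in X}) :
  slt_at R x -> exists f : fiber p y -> fiber p x, continuous f /\
    forall e, lift_between (path_rev a) (\val e) (\val (f e)).
Proof.
move=> sltx.
have pval z (e : fiber p z) : p (\val e) = z by case: e => e /= /set_mem.
have ca : continuous (path_rev a) by apply: path_rev_continuous; exact: cts_fun.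
have ex (e : fiber p y) : exists e' : fiber p x,
    lift_between (path_rev a) (\val e) (\val e').
  have [|e' ee'] := lift_between_exists (e := \val e) ca.
    by rewrite path_rev0 path_one pval.
  have e'x : e' \in p @^-1` [set x].
    rewrite inE /=; move: ee' => [A [_ _ <- pA]].
    by rewrite -[p _]/((p \o A) one) pA path_rev1 path_zero.
  by exists (exist _ e' e'x).
have [f fP] := choice ex.
exists f; split=> //; apply: continuous_comp_initial => e W eW.
have [N eN NW] := lift_between_continuous sltx (pval _ e) (fP e) eW.
have nN : nbhs e ((set_val : fiber p y -> E) @^-1` N).
  exact: (@initial_continuous (fiber p y) E set_val e N eN).
apply: (@filterS _ (nbhs e) _ _ _ _ nN) => e1 Ne1 /=.
exact: NW Ne1 (pval _ e1) (fP e1).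
Qed.

End covering.

Theorem corollary2p14 (R : realType) (X : topologicalType)
  (X_pc : path_connected R [set: X]) (X_slt : slt_space R X)
  (E : topologicalType) (p : E -> X) (p_cov : lpc0_covering R p) (x y : X) :
  homeomorphic (fiber p x) (fiber p y).
Proof.
have [a _] := X_pc x y Logic.I Logic.I.
have [|||b bE] := @path_of_continuous R X y x (path_rev a).
- by apply: path_rev_continuous; exact: cts_fun.
- by rewrite path_rev0 path_one.
- by rewrite path_rev1 path_zero.
have [f [cf fP]] := fiber_transport p_cov b (X_slt y).
have [g [cg gP]] := fiber_transport p_cov a (X_slt x).
exists f, g; split=> // e; apply: val_inj.
- apply: (lift_between_fun p_cov) (gP _) _.
  by rewrite -bE -[X in lift_between p X]path_revK; exact: lift_between_rev.
- apply: (lift_between_fun p_cov) (fP _) _; rewrite bE.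
  exact: lift_between_rev.
Qed.
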